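(* Let $X=\{x_1,\dots,x_n\}$ be a finite set with $n$ elements, let $(X,r)$ be a set-theoretic solution of the quantum Yang-Baxter equation, and let $A$ be the $n^2\times n^2$ matrix associated to $(X,r)$. The following are equivalent: 1. The solution $(X,r)$ is involutive and non-degenerate. 2. If $A$ is divided in the natural way into $n\times n$ blocks, then each block has exactly one entry equal to $1$ and all its other entries are zero. Moreover, $A$ is a permutation matrix which is symmetric, and $A^2$ is the identity matrix. In particular, $A$ is unitary.
   Context: A set-theoretic solution of the quantum Yang-Baxter equation is a pair $(X,r)$ with $X$ a non-empty set and $r:X\times X\to X\times X$ a bijection, written $r(x,y)=(\sigma_x(y),\tau_y(x))$, satisfying $r_1r_2r_1=r_2r_1r_2$ on $X^3$, where $r_1=r\times \mathrm{id}_X$, $r_2=\mathrm{id}_X\times r$. It is non-degenerate if all $\sigma_x,\tau_x$ ($x\in X$) are permutations of $X$, and involutive if $r^2=\mathrm{id}$. The matrix associated to $(X,r)$ has rows and columns indexed by the pairs $(i,j)$, $1\le i,j\le n$, in lexicographical order; the entry at the intersection of the column indexed by $(i,j)$ and the row indexed by $(k,l)$ is $1$ if $r(x_i,x_j)=(x_k,x_l)$ and $0$ otherwise. The natural division into $n\times n$ blocks has, for each $i,k$, the block formed by columns $(i,1),\dots,(i,n)$ and rows $(k,1),\dots,(k,n)$. *)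

(* Defs.v *)
From mathcomp Require Import all_boot all_order all_algebra.

Set Implicit Arguments.
Unset Strict Implicit.
Unset Printing Implicit Defensive.

Import GRing.Theory.
Local Open Scope ring_scope.

Section SetTheoreticSolutions.
Variables (X : Type) (r : X * X -> X * X).

Definition sigma (x y : X) : X := (r (x, y)).1.
Definition tau (y x : X) : X := (r (x, y)).2.

Definition r12 (t : X * X * X) : X * X * X :=
  let: (x, y, z) := t in (r (x, y), z).

Definition r23 (t : X * X * X) : X * X * X :=
  let: (x, y, z) := t in (x, (r (y, z)).1, (r (y, z)).2).

Definition yb_solution : Prop :=
  [/\ inhabited X, bijective r
    & forall t, r12 (r23 (r12 t)) = r23 (r12 (r23 t))].

Definition yb_nondegenerate : Prop :=
  forall x, bijective (sigma x) /\ bijective (tau x).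

End SetTheoreticSolutions.

Section SolutionMatrix.
Variables (R : nzRingType) (n : nat).

(* The pair of indices at a given position of the lexicographical order; this
   is the inverse of mxvec_index, whose value is computed in lex_indexE. *)
Definition lex_pair (a : 'I_(n * n)) : 'I_n * 'I_n :=
  enum_val (cast_ord (esym (mxvec_cast n n)) a).

(* Both indices are 0-based: x enumerates X as x 0, ..., x (n - 1). *)
Definition sol_mx (X : eqType) (r : X * X -> X * X) (x : 'I_n -> X) :
    'M[R]_(n * n) :=
  \matrix_(a, b)
    let: (k, l) := lex_pair a in
    let: (i, j) := lex_pair b in
    (r (x i, x j) == (x k, x l))%:R.

(* Rows (k, 0), ..., (k, n - 1) and columns (i, 0), ..., (i, n - 1). *)
Definition lex_block (A : 'M[R]_(n * n)) (k i : 'I_n) : 'M[R]_n :=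
  mxsub (mxvec_index k) (mxvec_index i) A.

Definition exactly_one_1 (B : 'M[R]_n) : Prop :=
  exists l j, B l j = 1 /\
    forall l' j', (l', j') <> (l, j) -> B l' j' = 0.

Lemma lex_indexE (i j : 'I_n) : mxvec_index i j = (i * n + j)%N :> nat.
Proof.
have E (S T : eqType) (s : seq S) (t : seq T) a b : a \in s -> b \in t ->
    index (a, b) [seq (u, v) | u <- s, v <- t]
    = (index a s * size t + index b t)%N.
  move=> + bt; elim: s => //= c s IHs; rewrite index_cat size_map inE eq_sym.
  case: eqVneq => [-> _|ca /= as_].
    by rewrite map_f // index_map // => u v [].
  rewrite ifF; first by rewrite IHs // mulSn addnA.
  by apply/negP => /mapP[v _ [e _]]; rewrite e eqxx in ca.
rewrite /mxvec_index /=.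
rewrite -[LHS](index_uniq (i, j) (s := enum {: 'I_n * 'I_n})).
- rewrite (nth_enum_rank (i, j)) enumT unlock /= /prod_enum.
  by rewrite E ?mem_enum // !index_enum_ord size_enum_ord.
- by rewrite -cardE ltn_ord.
- exact: enum_uniq.
Qed.

Lemma sol_mxE (X : eqType) (r : X * X -> X * X) (x : 'I_n -> X) i j k l :
  sol_mx r x (mxvec_index k l) (mxvec_index i j)
  = (r (x i, x j) == (x k, x l))%:R.
Proof. by rewrite mxE /lex_pair !cast_ordK !enum_rankK. Qed.

End SolutionMatrix.

(* Main.v *)
Require Import Defs.
From mathcomp Require Import all_boot all_order all_fingroup all_algebra.

Set Implicit Arguments.
Unset Strict Implicit.
Unset Printing Implicit Defensive.

Import GRing.Theory.
Local Open Scope ring_scope.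

(** The matrix of a bijective map is always a permutation matrix, hence unitary;
    it is symmetric exactly when the map is involutive
    ([trmx_sol_mx_involutive]), and then its square is the identity.  The
    block [(k, i)] has a [1] in column [j] exactly when
    [sigma (x i) (x j) = x k], so the blocks have one entry [1] each exactly
    when all the maps [sigma y] are bijective.

    What the matrix does not show is the bijectivity of the maps [tau y].  For a
    finite involutive solution it follows from that of the maps [sigma y], by a
    theorem of Rump on cycle sets.  Put [lam y = (sigma y)^-1].  The first
    component of the braid equation becomes the cycle set identity
      lam (lam y z) o lam y = lam (lam z y) o lam z,
    which says that [lam] extends to multisets of points ([cycle_act_perm]):
    the multiset obtained by adding [y] to [w] acts by [lam y] followed by the
    action of the image of [w] under [lam y].  Let the multiset of all the
    points of [X] act.  Singling out a point [y] factors this action as [lam y]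
    followed by the action of [lam y (X - y) = X - lam y y], so [lam y]
    depends only on [lam y y].  Hence [y |-> lam y y] is injective
    ([cycle_diag_inj]), and the injectivity of [tau y] follows by one more use
    of the cycle set identity ([involutive_tau_bij]). *)

(** * Finite cycle sets *)

(** The action of a word on [X]: the letter [y] is transported by the
    permutation [f] accumulated so far before it acts.  The initial value of
    the accumulator is kept as a parameter for the sake of induction. *)
Definition cycle_act (X : finType) (lam : X -> {perm X}) (f : {perm X})
    (w : seq X) : {perm X} :=
  foldl (fun (g : {perm X}) y => g * lam (g y))%g f w.

Definition cycle_law (X : finType) (lam : X -> {perm X}) : Prop :=
  forall y z, (lam y * lam (lam y z) = lam z * lam (lam z y))%g.

Lemma cycle_act_mul (X : finType) (lam : X -> {perm X}) (g f : {perm X}) w :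
  cycle_act lam (g * f)%g w = (g * cycle_act lam f (map g w))%g.
Proof. by elim: w f => //= y w IHw f; rewrite -IHw permM mulgA. Qed.

(** The cycle set identity is the exchange of two consecutive letters. *)
Lemma cycle_act_perm (X : finType) (lam : X -> {perm X}) (f : {perm X}) w1 w2 :
  cycle_law lam -> perm_eq w1 w2 -> cycle_act lam f w1 = cycle_act lam f w2.
Proof.
move=> lamP.
have swap g y z w :
    cycle_act lam g (y :: z :: w) = cycle_act lam g (z :: y :: w).
  by rewrite /cycle_act /= !permM -!mulgA lamP.
have move_in g y u v : cycle_act lam g (y :: u ++ v)
                       = cycle_act lam g (u ++ y :: v).
  by elim: u g => [//|z u IHu] g; rewrite cat_cons swap; apply: IHu.
apply: catCA_perm_subst => u v t; elim: u f => [//|y u IHu] f.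
by rewrite !cat_cons -move_in; apply: IHu.
Qed.

(** The action of the multiset of all points does not depend on the letter [y]
    that is read first, and after [lam y] the remaining letters form the
    multiset of all points but [lam y y]; so [lam y y] determines [lam y]. *)
Lemma cycle_diag_inj (X : finType) (lam : X -> {perm X}) :
  cycle_law lam -> injective (fun y => lam y y).
Proof.
move=> lamP.
have full y : cycle_act lam 1%g (enum X)
    = (lam y * cycle_act lam 1%g (rem (lam y y) (enum X)))%g.
  have split_at (z : X) : perm_eq (enum X) (z :: rem z (enum X)).
    by apply: perm_to_rem; rewrite mem_enum.
  rewrite (cycle_act_perm _ lamP (split_at y)) /= {1}/cycle_act /=.
  rewrite perm1 mul1g -/(cycle_act _ _ _) -{1}[lam y]mulg1 cycle_act_mul.
  congr (_ * _)%g; apply: cycle_act_perm lamP _.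
  rewrite -(perm_cons (lam y y)) -map_cons.
  apply: perm_trans (split_at (lam y y)).
  have lamE : perm_eq (map (lam y) (enum X)) (enum X).
    apply: uniq_perm; rewrite ?(map_inj_uniq perm_inj) ?enum_uniq // => z.
    rewrite mem_enum -[z](permKV (lam y)) mem_map ?mem_enum //.
    exact: perm_inj.
  by apply: perm_trans lamE; rewrite perm_sym; apply: perm_map.
move=> y z yz; apply: (@perm_inj _ (lam y)).
have lam_yz : lam y = lam z.
  by have := full y; rewrite (full z) yz => /mulIg.
by rewrite [in RHS]lam_yz.
Qed.

(** * Involutive solutions *)

Lemma involutive_sigma_tau (X : Type) (r : X * X -> X * X) y z :
  involutive r -> sigma r (sigma r y z) (tau r z y) = y.
Proof. by move=> rK; rewrite /sigma /tau -surjective_pairing rK. Qed.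

Lemma yb_sigma (X : Type) (r : X * X -> X * X) y z t : yb_solution r ->
  sigma r y (sigma r z t) = sigma r (sigma r y z) (sigma r (tau r z y) t).
Proof.
case=> _ _ /(_ (y, z, t)) /(congr1 (fun u => u.1.1)).
rewrite /r12 /r23 /sigma /tau.
by case: (r (y, z)) (r (y, (r (z, t)).1)) => [a b] [c d] /= ->.
Qed.

(** If [tau z y = tau z y' = b], put [v = sigma y z] and [v' = sigma y' z].  The
    cycle set identity for [y] and [v], evaluated at [v], says that the
    diagonal values of [lam] at [v] and at [v'] are both sent by [lam b] to that
    at [z]; so [v = v'] by [cycle_diag_inj], and [y = sigma v b = y']. *)
Lemma involutive_tau_bij (X : finType) (r : X * X -> X * X) :
  yb_solution r -> involutive r -> (forall y, injective (sigma r y)) ->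
  forall z, bijective (tau r z).
Proof.
move=> hr rK sI z.
pose lam y : {perm X} := (perm (@sI y))^-1%g.
have lamK y t : lam y (sigma r y t) = t.
  by rewrite -[sigma r y t](permE (@sI y)) permK.
have sigmaK y t : sigma r y (lam y t) = t.
  by rewrite -[LHS](permE (@sI y)) permKV.
have lam_tau y t : lam (sigma r y t) y = tau r t y.
  by rewrite -{2}[y](involutive_sigma_tau y t rK) lamK.
have lam_sigma y t u :
    lam t (lam y u) = lam (tau r t y) (lam (sigma r y t) u).
  rewrite -[u in RHS](sigmaK y) -[lam y u in RHS](sigmaK t).
  by rewrite (yb_sigma _ _ _ hr) !lamK.
have lamP : cycle_law lam.
  move=> y v; apply/permP => t; rewrite !permM.
  by rewrite lam_sigma -lam_tau sigmaK.
have diag y : lam z z = lam (tau r z y) (lam (sigma r y z) (sigma r y z)).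
  by rewrite -lam_sigma lamK.
apply: injF_bij => y y' tau_yy'.
have sigma_yy' : sigma r y z = sigma r y' z.
  apply: (cycle_diag_inj lamP); apply: (@perm_inj _ (lam (tau r z y))).
  by rewrite -diag tau_yy' -diag.
rewrite -(involutive_sigma_tau y z rK) sigma_yy' tau_yy'.
exact: involutive_sigma_tau.
Qed.

(** * The matrix of a solution *)

Definition lex_point n (X : Type) (x : 'I_n -> X) (a : 'I_(n * n)) : X * X :=
  (x (lex_pair a).1, x (lex_pair a).2).

Lemma lex_point_bij n (X : Type) (x : 'I_n -> X) :
  bijective x -> bijective (lex_point x).
Proof.
move=> [x' xK x'K].
have : bijective (@lex_pair n).
  apply: bij_comp; first exact: enum_val_bij.
  by exists (cast_ord (mxvec_cast n n)) => a; rewrite ?cast_ordK ?cast_ordKV.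
case=> idx pairK idxK; exists (fun u => idx (x' u.1, x' u.2)) => [a|[u v]].
  by rewrite !xK -surjective_pairing pairK.
by rewrite /lex_point idxK !x'K.
Qed.

Lemma sol_mx_lex_point (R : nzRingType) n (X : eqType) (r : X * X -> X * X)
    (x : 'I_n -> X) a b :
  sol_mx R r x a b = (r (lex_point x b) == lex_point x a)%:R.
Proof.
by rewrite mxE /lex_point; case: (lex_pair a) => k l; case: (lex_pair b).
Qed.

Lemma sol_mx_perm (R : nzRingType) n (X : eqType) (r : X * X -> X * X)
    (x : 'I_n -> X) :
  bijective x -> injective r -> exists s : 'S_(n * n), sol_mx R r x = perm_mx s.
Proof.
move=> /lex_point_bij[idx pointK idxK] rI.
have fI : injective (fun a => idx (r (lex_point x a))).
  by move=> a b /(can_inj idxK) /rI /(can_inj pointK).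
(* Columns index the arguments of r, whereas perm_mx has its arguments in the
   rows: hence the inverse. *)
exists (perm fI)^-1%g; rewrite -tr_perm_mx; apply/matrixP => a b.
rewrite sol_mx_lex_point !mxE permE; congr (_ %:R).
by rewrite (can2_eq idxK pointK).
Qed.

Lemma trmx_sol_mx_involutive (R : nzRingType) n (X : eqType)
    (r : X * X -> X * X) (x : 'I_n -> X) :
  bijective x -> (sol_mx R r x)^T = sol_mx R r x <-> involutive r.
Proof.
move=> /lex_point_bij[idx _ idxK]; split=> [symA u | rK].
  have := congr1 (fun M : 'M_ _ => M (idx u) (idx (r u))) symA.
  rewrite mxE !sol_mx_lex_point !idxK eqxx.
  by case: eqP => // _ /eqP; rewrite oner_eq0.
apply/matrixP => a b; rewrite mxE !sol_mx_lex_point.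
by rewrite (can2_eq rK rK) eq_sym.
Qed.

Lemma perm_mx_unitary (C : numClosedFieldType) n (s : 'S_n) :
  perm_mx s \is @unitarymx C n n.
Proof.
apply/unitarymxP; rewrite tr_perm_mx map_perm_mx -perm_mxM mulgV.
exact: perm_mx1.
Qed.

Lemma lex_block_sol_mx (R : nzRingType) n (X : eqType) (r : X * X -> X * X)
    (x : 'I_n -> X) (k i l j : 'I_n) :
  lex_block (sol_mx R r x) k i l j = (r (x i, x j) == (x k, x l))%:R.
Proof. by rewrite mxE sol_mxE. Qed.

(** Column [j] of the block [(k, i)] can only have its [1] in the row of
    [tau (x j) (x i)], so the block tests the equation
    [sigma (x i) (x j) = x k] in [j]. *)
Lemma exactly_one_1_sigma_bij (R : nzRingType) n (X : finType)
    (r : X * X -> X * X) (x : 'I_n -> X) : bijective x ->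
  (forall k i, exactly_one_1 (lex_block (sol_mx R r x) k i)) <->
  (forall y, bijective (sigma r y)).
Proof.
move=> [x' xK x'K]; split=> [block1 y | sB k i].
  have sigma_onto z : exists t, sigma r y t == z.
    have [l [j []]] := block1 (x' z) (x' y).
    rewrite lex_block_sol_mx !x'K.
    case: eqP => [rE _ _ | _ /eqP]; last by rewrite eq_sym oner_eq0.
    by exists (x j); rewrite /sigma rE.
  have sigmaK : cancel (fun z => xchoose (sigma_onto z)) (sigma r y).
    by move=> z; apply/eqP/(xchooseP (sigma_onto z)).
  by apply: (bij_can_bij _ sigmaK); apply: injF_bij (can_inj sigmaK).
have [s sK Ks] := sB (x i).
exists (x' (tau r (s (x k)) (x i))), (x' (s (x k))); split.
  rewrite lex_block_sol_mx !x'K [r _]surjective_pairing.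
  by rewrite -/(sigma r _ _) -/(tau r _ _) Ks eqxx.
move=> l j lj; rewrite lex_block_sol_mx; case: eqP => // rE; case: lj.
have jE : x j = s (x k) by rewrite -[x j]sK /sigma rE.
by rewrite -jE xK /tau rE xK.
Qed.

Theorem proposition42 (C : numClosedFieldType) (n : nat) (X : finType)
    (x : 'I_n -> X) (hx : bijective x)
    (r : X * X -> X * X) (hr : yb_solution r) :
  let A : 'M[C]_(n * n) := sol_mx C r x in
  (involutive r /\ yb_nondegenerate r) <->
  [/\ forall k i : 'I_n, exactly_one_1 (lex_block A k i),
      is_perm_mx A,
      A^T = A,
      A *m A = 1%:M
    & A \is unitarymx].
Proof.
move=> A; split=> [[rK nd] | [block1 _ symA _ _]].
  have symA : A^T = A by apply/trmx_sol_mx_involutive.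
  have [s As] := sol_mx_perm C hx (inv_inj rK).
  split=> //.
  - by apply/exactly_one_1_sigma_bij => // y; case: (nd y).
  - by apply/is_perm_mxP; exists s.
  - rewrite -{2}symA /A As tr_perm_mx -perm_mxM mulgV; exact: perm_mx1.
  - by rewrite /A As perm_mx_unitary.
have rK : involutive r by apply/(trmx_sol_mx_involutive C r hx).
have sB : forall y, bijective (sigma r y).
  by apply/(exactly_one_1_sigma_bij C r hx).
split=> // y; split=> //.
by apply: involutive_tau_bij => // z; apply: bij_inj.
Qed.
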